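(* Let $B$ be a Polish metric space, let $\mathcal{E}=(E,d_E,f,\mu)$ and $\mathcal{F}=(E,d_E,g,\nu)$ be $mm$-fields over $B$ with the same underlying metric space $(E,d_E)$, and let $X,Y\subseteq E$ be compact subspaces. Then: (i) $d_I(N^{*,*}(X,\mathcal{E}),N^{*,*}(Y,\mathcal{F}))\le d_H(X,Y)+2\sup_{y\in E}d_B(f(y),g(y))$. (ii) $d_I(N^{*,*,*}(\mathcal{E}),N^{*,*,*}(\mathcal{F}))\le d_P(\mu,\nu)+2\sup_{y\in E}d_B(f(y),g(y))$.
   Context: A Polish metric space is a complete separable metric space. An $mm$-field over a Polish metric space $(B,d_B)$ is a quadruple $\mathcal{E}=(E,d_E,\pi_E,\mu_E)$, where $(E,d_E)$ is a Polish metric space, $\pi_E\colon E\to B$ is 1-Lipschitz and $\mu_E$ is a Borel probability measure on $E$. For $y\in E$ and $r,s\ge0$ put $$B_{r,s}(y,\mathcal{E})=\{y'\in E: d_E(y,y')\le r\ \text{and}\ d_B(\pi_E(y),\pi_E(y'))\le s\}.$$ Field neighborhood bifiltration of a (nonempty) compact $X\subseteq E$: $N^{r,s}(X,\mathcal{E})=\bigcup_{x\in X}B_{r,s}(x,\mathcal{E})=\{y\in E:\exists x\in X,\ d_E(x,y)\le r,\ d_B(\pi_E(x),\pi_E(y))\le s\}$, for $r,s\ge0$ (it depends only on the underlying field of $\mathcal{E}$). $mm$-field neighborhood trifiltration: $N^{r,s,t}(\mathcal{E})=\{y\in E:\mu_E(B_{r,s}(y,\mathcal{E}))\ge1-t\}$,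 for $r,s,t\ge0$. Both are nondecreasing in all parameters and are viewed as functors from the poset $[0,\infty)^k$ ($k=2,3$) to topological spaces with inclusions as structure maps. Two such functors $M,N$ are $\delta$-interleaved ($\delta\ge0$) if there are natural transformations $M^{a}\to N^{a+\delta(1,\dots,1)}$ and $N^{a}\to M^{a+\delta(1,\dots,1)}$ whose two composites are the structure maps $M^a\to M^{a+2\delta(1,\dots,1)}$ and $N^a\to N^{a+2\delta(1,\dots,1)}$. The interleaving distance $d_I$ is the infimum of all such $\delta$ ($\infty$ if none). $d_H$ is the Hausdorff distance in $E$ and $d_P$ is the Prokhorov distance between Borel probability measures on $E$. *)

(* Defs.v *)
From HB Require Import structures.
From mathcomp Require Import all_boot all_order all_algebra.
From mathcomp Require Import all_classical all_reals all_analysis.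
Set Implicit Arguments.
Unset Strict Implicit.
Unset Printing Implicit Defensive.
Import Order.TTheory GRing.Theory Num.Theory.
Import numFieldNormedType.Exports.
Local Open Scope classical_set_scope.
Local Open Scope ring_scope.

(* [Complete] comes with a base point; a space carrying a probability measure,
   and a space mapped to by such a space, is nonempty, so nothing is lost. *)
HB.mixin Record isSeparable T & Topological T := {
  separable_dense : exists2 D : set T, countable D & dense D
}.

#[short(type="polishMetricType")]
HB.structure Definition PolishMetric (R : realType) :=
  {T of Metric R T & Complete T & isSeparable T}.

Notation borel E := (g_sigma_algebraType (@open E)).

Record fieldOver (R : realType) (B E : polishMetricType R) := FieldOver {
  fproj :> E -> B;
  fproj_lipschitz : forall x y, mdist (fproj x) (fproj y) <= mdist x y
}.

(* The metric space E is a parameter of the type rather than a component,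
   so that two mm-fields can have the same underlying metric space. *)
Record mmField (R : realType) (B E : polishMetricType R) := MMField {
  mm_field :> fieldOver B E;
  mm_law : probability (borel E) R
}.

Section persistent_spaces.
Variables (R : realType) (k : nat).

Definition grade := 'I_k -> {nonneg R}.

Definition le_grade (a b : grade) : Prop := forall i, a i <= b i.

Definition translate (d : {nonneg R}) (a : grade) : grade :=
  fun i => ((a i)%:num + d%:num)%:nng.

Lemma le_translate d a b : le_grade a b -> le_grade (translate d a) (translate d b).
Proof. by move=> ab i; rewrite -num_le/= lerD2r; exact: ab. Qed.

Lemma le_translate2 d a : le_grade a (translate d (translate d a)).
Proof. by move=> i; rewrite -num_le/= -addrA lerDl. Qed.

(* A functor from the poset [0, oo)^k to topological spaces. *)
Record pspace := PSpace {
  pspace_at :> grade -> topologicalType;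
  pmap : forall a b, le_grade a b -> pspace_at a -> pspace_at b;
  pmap_continuous : forall a b (ab : le_grade a b), continuous (pmap ab);
  pmap_id : forall a (aa : le_grade a a) x, pmap aa x = x;
  pmap_comp : forall a b c (ab : le_grade a b) (bc : le_grade b c)
    (ac : le_grade a c) x, pmap bc (pmap ab x) = pmap ac x
}.
Arguments pmap p {a b} ab x.
Arguments pmap_continuous p {a b} ab.
Arguments pmap_id p {a} aa x.
Arguments pmap_comp p {a b c} ab bc ac x.

Record nat_trans (M N : pspace) := NatTrans {
  nt_at :> forall a, M a -> N a;
  nt_continuous : forall a, continuous (@nt_at a);
  nt_natural : forall a b (ab : le_grade a b) x,
    @nt_at b (pmap M ab x) = pmap N ab (@nt_at a x)
}.
Arguments nt_at {M N} _ a _.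

Definition translated (d : {nonneg R}) (M : pspace) : pspace := {|
  pspace_at := fun a => M (translate d a);
  pmap := fun a b ab => pmap M (le_translate d ab);
  pmap_continuous := fun a b ab => pmap_continuous M (le_translate d ab);
  pmap_id := fun a aa => pmap_id M (le_translate d aa);
  pmap_comp := fun a b c ab bc ac =>
    pmap_comp M (le_translate d ab) (le_translate d bc) (le_translate d ac)
|}.

(* a + 2d (1, 1, ...) is written [translate d (translate d a)]. *)
Definition interleaved (d : {nonneg R}) (M N : pspace) : Prop :=
  exists (phi : nat_trans M (translated d N)) (psi : nat_trans N (translated d M)),
    (forall a x, psi (translate d a) (phi a x) = pmap M (le_translate2 d a) x) /\
    (forall a x, phi (translate d a) (psi a x) = pmap N (le_translate2 d a) x).

Definition interleaving_dist (M N : pspace) : \bar R :=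
  ereal_inf [set d%:num%:E | d in [set d : {nonneg R} | interleaved d M N]].

End persistent_spaces.

Lemma subfun_continuous (T : topologicalType) (A B : set T) (AB : A `<=` B) :
  continuous (subfun AB : A -> B).
Proof.
apply/continuousP => _ [V oV <-]; exists V => //.
Qed.

Section filtrations.
Variables (R : realType) (k : nat) (T : topologicalType).
Variables (A : grade R k -> set T).
Hypothesis A_mono : forall a b, le_grade a b -> A a `<=` A b.

Lemma subfun_id a (aa : le_grade a a) x : subfun (A_mono aa) x = x.
Proof. exact: val_inj. Qed.

Lemma subfun_comp a b c (ab : le_grade a b) (bc : le_grade b c)
    (ac : le_grade a c) x :
  subfun (A_mono bc) (subfun (A_mono ab) x) = subfun (A_mono ac) x.
Proof. exact: val_inj. Qed.

Definition filtration : pspace R k := {|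
  pspace_at := fun a => (A a : topologicalType);
  pmap := fun a b ab => subfun (A_mono ab);
  pmap_continuous := fun a b ab => @subfun_continuous _ _ _ (A_mono ab);
  pmap_id := subfun_id;
  pmap_comp := subfun_comp
|}.

End filtrations.

Section neighborhoods.
Variables (R : realType) (B E : polishMetricType R).

Definition fball (F : fieldOver B E) (r s : R) (y : E) : set E :=
  [set y' | mdist y y' <= r /\ mdist (F y) (F y') <= s].

Lemma subset_fball F r s r' s' y :
  r <= r' -> s <= s' -> fball F r s y `<=` fball F r' s' y.
Proof.
by move=> rr ss y' [? ?]; split; [exact: le_trans rr|exact: le_trans ss].
Qed.

Lemma measurable_fball (F : fieldOver B E) r s y :
  measurable (fball F r s y : set (borel E)).
Proof.
rewrite -(setCK (fball F r s y)); apply: measurableC; apply: sub_sigma_algebra.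
rewrite openE => x; rewrite /fball /setC/= => /not_andP[|] /negP.
- rewrite -ltNge => ryx; apply/nbhs_ballP.
  exists (mdist y x - r) => /=; first by rewrite subr_gt0.
  move=> z; rewrite ballEmdist /= ltrBrDr => h [yz _].
  have := metric_triangle y z x; rewrite (metric_sym z x) leNgt => /negP; apply.
  by apply: le_lt_trans h; rewrite addrC lerD2l.
- rewrite -ltNge => syx; apply/nbhs_ballP.
  exists (mdist (F y) (F x) - s) => /=; first by rewrite subr_gt0.
  move=> z; rewrite ballEmdist /= ltrBrDr => h [_ yz].
  have := metric_triangle (F y) (F z) (F x).
  rewrite (metric_sym (F z) (F x)) leNgt => /negP; apply.
  apply: le_lt_trans h; rewrite addrC lerD//; exact: fproj_lipschitz.
Qed.

Definition fnbhd (F : fieldOver B E) (X : set E) (a : grade R 2) : set E :=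
  \bigcup_(x in X) fball F (a 0)%:num (a 1)%:num x.

Lemma fnbhd_mono F X a b : le_grade a b -> fnbhd F X a `<=` fnbhd F X b.
Proof.
by move=> ab; apply: subset_bigcup => x _; apply: subset_fball; exact: ab.
Qed.

Definition fnbhd_bifiltration F X : pspace R 2 := filtration (@fnbhd_mono F X).

Definition mmnbhd (F : mmField B E) (a : grade R 3) : set E :=
  [set y | ((1 - (a 2)%:num)%:E <=
            mm_law F (fball F (a 0)%R%:num (a 1)%R%:num y))%E].

Lemma mmnbhd_mono F a b : le_grade a b -> mmnbhd F a `<=` mmnbhd F b.
Proof.
move=> ab y; rewrite /mmnbhd /= => h; apply: (@le_trans _ _ (1 - (a 2)%:num)%:E).
  by rewrite lee_fin lerD2l lerN2; exact: ab.
apply: (le_trans h); apply: le_measure; rewrite ?inE; try exact: measurable_fball.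
by apply: subset_fball; exact: ab.
Qed.

Definition mmnbhd_trifiltration F : pspace R 3 := filtration (@mmnbhd_mono F).

End neighborhoods.

Section distances.
Variables (R : realType) (E : polishMetricType R).
Local Open Scope ereal_scope.

Definition set_dist (x : E) (A : set E) : \bar R :=
  ereal_inf [set (mdist x a)%:E | a in A].

(* The usual distance for nonempty sets only. *)
Definition hausdorff_dist (X Y : set E) : \bar R :=
  maxe (ereal_sup [set set_dist x Y | x in X])
       (ereal_sup [set set_dist y X | y in Y]).

Definition thickening (A : set E) (e : R) : set E := \bigcup_(a in A) ball a e.

Definition prokhorov_dist (P Q : probability (borel E) R) : \bar R :=
  ereal_inf [set e%:E | e in [set e : R | (0 < e)%R /\
    forall A : set (borel E), measurable A ->
      P A <= Q (thickening A e) + e%:E /\ Q A <= P (thickening A e) + e%:E]].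

(* sup_y d_B (f y, g y), possibly +oo. *)
Definition unif_dist (B : polishMetricType R) (f g : E -> B) : \bar R :=
  ereal_sup (range (fun y => (mdist (f y) (g y))%:E)).

End distances.

(* Main.v *)
Require Import Defs.
From HB Require Import structures.
From mathcomp Require Import all_boot all_order all_algebra.
From mathcomp Require Import all_classical all_reals all_analysis.
From mathcomp Require Import lra.
Set Implicit Arguments.
Unset Strict Implicit.
Unset Printing Implicit Defensive.
Import Order.TTheory GRing.Theory Num.Theory.
Import numFieldNormedType.Exports.
Local Open Scope classical_set_scope.
Local Open Scope ring_scope.

(** Both filtrations consist of subspaces of the same space, so an
    interleaving is obtained as soon as there are inclusions
    [A a `<=` C (a + d)] and [C a `<=` A (a + d)] for all [a]
    ([interleaving_dist_filtration_le]): the required diagrams commute because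
    all maps are restrictions of the identity.

    The inclusions come from one application of the triangle inequality in [E]
    and one in [B] ([fball_perturb]).  If the projections [f] and [g] are within
    [c] of each other and [x], [x'] are within [e] of each other, then
    [d_B (g x', g y) <= d_B (g x', g x) + d_B (g x, f x) + d_B (f x, f y)
    + d_B (f y, g y)]; the first term is at most [e] because [g] is
    1-Lipschitz, and the comparison of [f] with [g] is paid for twice.  This is
    the origin of the summand [2 sup d_B (f y, g y)].

    For the bifiltration, [e > d_H (X, Y)] allows a centre [x] in [X] to be
    replaced by a centre [x'] in [Y].  For the trifiltration, the centre is
    kept and the estimate says that the [e]-thickening of a ball of [f] lies in
    a larger ball of [g]; the defining inequality of the Prokhorov distance
    then transfers the lower bound on the mass, at the cost of [e].  Letting
    [e] decrease to the distance gives the theorem ([le_dist_add_unif]). *)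

(** * Interleavings of filtrations by subspaces *)

Lemma subfun_nat_trans (R : realType) (k : nat) (T : topologicalType)
    (A C : grade R k -> set T)
    (A_mono : forall a b, le_grade a b -> A a `<=` A b)
    (C_mono : forall a b, le_grade a b -> C a `<=` C b)
    (d : {nonneg R}) (AC : forall a, A a `<=` C (translate d a)) :
  exists phi : nat_trans (filtration A_mono) (translated d (filtration C_mono)),
    forall a x, phi a x = subfun (AC a) x.
Proof.
unshelve eexists.
  unshelve eapply NatTrans.
  - by move=> a; exact: (subfun (AC a)).
  - by move=> a; exact: subfun_continuous.
  - by move=> a b ab x; exact: val_inj.
by [].
Qed.

Lemma interleaving_dist_filtration_le (R : realType) (k : nat)
    (T : topologicalType) (A C : grade R k -> set T)
    (A_mono : forall a b, le_grade a b -> A a `<=` A b)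
    (C_mono : forall a b, le_grade a b -> C a `<=` C b) (d : {nonneg R}) :
  (forall a, A a `<=` C (translate d a)) ->
  (forall a, C a `<=` A (translate d a)) ->
  (interleaving_dist (filtration A_mono) (filtration C_mono) <= d%:num%:E)%E.
Proof.
move=> AC CA; apply: ereal_inf_lbound; exists d => //=.
have [phi phiE] := subfun_nat_trans A_mono C_mono AC.
have [psi psiE] := subfun_nat_trans C_mono A_mono CA.
exists phi, psi; split=> a x.
- by rewrite phiE psiE; exact: val_inj.
- by rewrite psiE phiE; exact: val_inj.
Qed.

(** * Perturbation of the balls of a field *)

Section fball_perturbation.
Variables (R : realType) (B E : polishMetricType R).
Implicit Types (F G : fieldOver B E) (r s c e : R) (x y : E).

Lemma fball_sym F r s x y : fball F r s x y -> fball F r s y x.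
Proof. by move=> [? ?]; split; rewrite metric_sym. Qed.

(** The shift [e + c + c] of the first parameter is larger than the [e] that the
    triangle inequality gives, because an interleaving shifts all parameters
    by the same amount. *)
Lemma fball_perturb F G c e r s x x' y :
  0 <= c -> (forall z, mdist (F z) (G z) <= c) -> mdist x x' <= e ->
  fball F r s x y -> fball G (r + (e + c + c)) (s + (e + c + c)) x' y.
Proof.
move=> c0 FG xx' [xy Fxy]; split.
  have := metric_triangle x' x y; rewrite (metric_sym x' x); lra.
have GF z : mdist (G z) (F z) <= c by rewrite metric_sym.
have Gx'x : mdist (G x') (G x) <= e.
  by rewrite metric_sym; apply: le_trans xx'; exact: fproj_lipschitz.
have := metric_triangle (G x') (G x) (G y).
have := metric_triangle (G x) (F x) (G y).
have := metric_triangle (F x) (F y) (G y).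
by have := FG y; have := GF x; lra.
Qed.

Lemma thickening_fball F G c e r s y :
  0 <= c -> (forall z, mdist (F z) (G z) <= c) ->
  thickening (fball F r s y) e `<=`
  fball G (r + (e + c + c)) (s + (e + c + c)) y.
Proof.
move=> c0 FG z [x yx]; rewrite ballEmdist /= => xz.
apply: fball_sym; apply: (fball_perturb c0 FG (ltW xz)); exact: fball_sym.
Qed.

End fball_perturbation.

(** * Distances *)

Section distances.
Variables (R : realType) (E : polishMetricType R).
Local Open Scope ereal_scope.

Lemma hausdorff_distC (X Y : set E) : hausdorff_dist X Y = hausdorff_dist Y X.
Proof. by rewrite /hausdorff_dist maxC. Qed.

Lemma hausdorff_dist_ge0 (X Y : set E) : X !=set0 -> 0 <= hausdorff_dist X Y.
Proof.
move=> [x Xx]; rewrite /hausdorff_dist le_max; apply/orP; left.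
apply: (@le_trans _ _ (set_dist x Y)).
  by apply: le_ereal_inf_tmp => _ [y _ <-]; rewrite lee_fin mdist_ge0.
by apply: ereal_sup_ubound; exists x.
Qed.

Lemma hausdorff_dist_lt (X Y : set E) (e : R) x :
  hausdorff_dist X Y < e%:E -> X x -> exists2 y, Y y & (mdist x y < e)%R.
Proof.
rewrite /hausdorff_dist gt_max => /andP[XYe _] Xx.
have xYe : set_dist x Y < e%:E.
  by apply: le_lt_trans XYe; apply: ereal_sup_ubound; exists x.
have [_ [y Yy <-]] := ereal_inf_lt xYe.
by rewrite lte_fin => xye; exists y.
Qed.

Lemma prokhorov_dist_ge0 (P Q : probability (borel E) R) :
  0 <= prokhorov_dist P Q.
Proof.
by apply: le_ereal_inf_tmp => _ [e [e0 _] <-]; rewrite lee_fin ltW.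
Qed.

Lemma prokhorov_distC (P Q : probability (borel E) R) :
  prokhorov_dist P Q = prokhorov_dist Q P.
Proof.
rewrite /prokhorov_dist; congr (ereal_inf (_ @` _)).
by apply/seteqP; split=> e [e0 PQ]; split=> // A /PQ[].
Qed.

Lemma measurable_thickening (A : set E) (e : R) :
  measurable (thickening A e : set (borel E)).
Proof.
apply: sub_sigma_algebra; apply: bigcup_open => a _.
rewrite openE => x; rewrite ballEmdist /= => axe; apply/nbhs_ballP.
exists (e - mdist a x)%R => /=; first by rewrite subr_gt0.
move=> z; rewrite !ballEmdist /= => xz.
by have := metric_triangle a x z; lra.
Qed.

(** The numbers admissible in the definition of the Prokhorov distance form an
    up-set, since thickenings grow with their radius. *)
Lemma prokhorov_dist_lt (P Q : probability (borel E) R) (e : R)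
    (A : set (borel E)) :
  prokhorov_dist P Q < e%:E -> measurable A ->
  P A <= Q (thickening A e) + e%:E.
Proof.
move=> /ereal_inf_lt[_ [e' [_ PQ] <-]]; rewrite lte_fin => e'e mA.
have [+ _] := PQ A mA => /le_trans; apply; apply: leeD; last first.
  by rewrite lee_fin ltW.
apply: le_measure; rewrite ?inE; try exact: measurable_thickening.
move=> z [a Aa]; rewrite ballEmdist /= => az.
by exists a => //; rewrite ballEmdist /=; exact: lt_trans e'e.
Qed.

Variable B : polishMetricType R.

Lemma unif_distC (f g : E -> B) : unif_dist f g = unif_dist g f.
Proof.
by rewrite /unif_dist; under eq_fun do rewrite metric_sym.
Qed.

Lemma unif_dist_ge (f g : E -> B) y : (mdist (f y) (g y))%:E <= unif_dist f g.
Proof. by apply: ereal_sup_ubound; exists y. Qed.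

Lemma unif_dist_ge0 (f g : E -> B) : 0 <= unif_dist f g.
Proof. by apply: le_trans (unif_dist_ge f g point); rewrite lee_fin mdist_ge0. Qed.

(** Reduction to finite distances, with the infimum replaced by a number
    strictly above it. *)
Lemma le_dist_add_unif (f g : E -> B) (D h : \bar R) :
  0 <= h ->
  (forall e c : R, (0 <= e)%R -> (0 <= c)%R -> h < e%:E ->
     unif_dist f g = c%:E -> D <= (e + c + c)%:E) ->
  D <= h + 2%:E * unif_dist f g.
Proof.
move=> h0 Dle; have := unif_dist_ge0 f g.
case uE : (unif_dist f g) => [c| |] //; last first.
  rewrite gt0_muley ?lte_fin// addey ?leey//.
  by rewrite gt_eqF// (lt_le_trans _ h0).
rewrite lee_fin => c0.
case: h h0 Dle => [h| |] // h0 Dle; last by rewrite addye ?leey.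
move: h0; rewrite lee_fin => h0; apply/lee_addgt0Pr => e e0.
apply: (@le_trans _ _ ((h + e) + c + c)%:E).
  by apply: Dle => //; [exact: addr_ge0 (ltW e0)|rewrite lte_fin ltrDl].
by rewrite -!EFinM -!EFinD lee_fin; lra.
Qed.

End distances.

(** * Inclusions between the filtrations *)

Section inclusions.
Variables (R : realType) (B E : polishMetricType R).

Lemma fnbhd_sub_translate (F G : fieldOver B E) (X Y : set E) (d : {nonneg R})
    (e c : R) (a : grade R 2) :
  0 <= c -> d%:num = e + c + c -> (hausdorff_dist X Y < e%:E)%E ->
  unif_dist F G = c%:E -> fnbhd F X a `<=` fnbhd G Y (translate d a).
Proof.
move=> c0 dE XYe FGc y [x Xx xy].
have [x' Yx' /ltW xx'] := hausdorff_dist_lt XYe Xx.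
exists x' => //; rewrite /translate /= dE; apply: fball_perturb xy => // z.
by rewrite -lee_fin -FGc; exact: unif_dist_ge.
Qed.

Lemma mmnbhd_sub_translate (F G : mmField B E) (d : {nonneg R}) (e c : R)
    (a : grade R 3) :
  0 <= c -> d%:num = e + c + c ->
  (prokhorov_dist (mm_law F) (mm_law G) < e%:E)%E ->
  unif_dist F G = c%:E -> mmnbhd F a `<=` mmnbhd G (translate d a).
Proof.
move=> c0 dE FGe FGc y; rewrite /mmnbhd /translate /= dE => Fy.
have FG z : mdist (F z) (G z) <= c.
  by rewrite -lee_fin -FGc; exact: unif_dist_ge.
have := prokhorov_dist_lt FGe
  (measurable_fball F (a 0)%:num (a 1)%:num y) => /(le_trans Fy).
rewrite -leeBlDr// -EFinB => Gy.
apply: (@le_trans _ _ (1 - (a 2)%:num - e)%:E); first by rewrite lee_fin; lra.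
apply: (le_trans Gy); apply: le_measure; rewrite ?inE.
- exact: measurable_thickening.
- exact: measurable_fball.
- exact: thickening_fball.
Qed.

End inclusions.

Theorem theorem7p3 (R : realType) (B E : polishMetricType R)
    (EE FF : mmField B E) (X Y : set E)
    (X_compact : compact X) (Y_compact : compact Y)
    (X_nonempty : X !=set0) (Y_nonempty : Y !=set0) :
  (interleaving_dist (fnbhd_bifiltration EE X) (fnbhd_bifiltration FF Y)
     <= hausdorff_dist X Y + 2%:E * unif_dist EE FF)%E /\
  (interleaving_dist (mmnbhd_trifiltration EE) (mmnbhd_trifiltration FF)
     <= prokhorov_dist (mm_law EE) (mm_law FF) + 2%:E * unif_dist EE FF)%E.
Proof.
split; apply: le_dist_add_unif.
- exact: hausdorff_dist_ge0.
- move=> e c e0 c0 XYe EFc.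
  have d0 : 0 <= e + c + c by rewrite !addr_ge0.
  apply: (@interleaving_dist_filtration_le _ _ _ _ _ _ _ (NngNum d0)) => a.
  + exact: (fnbhd_sub_translate c0).
  + apply: (fnbhd_sub_translate c0) => //.
      by rewrite hausdorff_distC.
    by rewrite unif_distC.
- exact: prokhorov_dist_ge0.
- move=> e c e0 c0 PQe EFc.
  have d0 : 0 <= e + c + c by rewrite !addr_ge0.
  apply: (@interleaving_dist_filtration_le _ _ _ _ _ _ _ (NngNum d0)) => a.
  + exact: (mmnbhd_sub_translate c0).
  + apply: (mmnbhd_sub_translate c0) => //.
      by rewrite prokhorov_distC.
    by rewrite unif_distC.
Qed.
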